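(* Let $\Bbbk$ be a field of characteristic different from $2$, let $A$ be a right $H(2)$-comodule algebra and $B=A^{coH(2)}$. If the extension $B\subseteq A$ is $H(2)$-cleft, then there is a cleft $H(2)$-datum $(\mathcal{F},c)$ for $B$ such that $A$ is isomorphic, as left $B$-module and right $H(2)$-comodule algebra, to the crossed product $\left(\dfrac{\mathcal{F},c}{B}\right)$.
   Context: All vector spaces, algebras and tensor products are over $\Bbbk$; Sweedler notation is used. $H(2)$ is the coquasi-Hopf algebra with basis $\{1,x\}$, $x$ grouplike, $x^2=1$ (as algebra and coalgebra it is $\Bbbk[C_2]$), reassociator $\omega(x,x,x)=-1$ and $\omega=1$ on all other triples of basis elements, antipode $S=\mathrm{id}$, $\beta(1)=\beta(x)=1$, $\alpha(1)=1$, $\alpha(x)=-1$. Right $H$-comodule algebra ($H=H(2)$): a right $H$-comodule $(A,\rho_A)$, $\rho_A(a)=a_0\otimes a_1$, with an $H$-colinear multiplication and an $H$-colinear two-sided unit $1_A$, such that $(ab)c=a_0(b_0c_0)\,\omega(a_1,b_1,c_1)$. $A^{coH}=\{a\in A:\rho_A(a)=a\otimes 1\}$, an associative unital algebra. Cleft: $B\subseteq A$ is $H$-cleft if there are a right $H$-colinear map $\gamma:H\to A$ and a linear map $\delta:H\to A$ with $\rho_A(\delta(h))=\delta(h_2)\otimes S(h_1)$, $\delta(h_1)\gamma(h_2)=\alpha(h)1_A$, $\gamma(h_1)\beta(h_2)\delta(h_3)=\varepsilon(h)1_A$ for all $h\in H$. Cleft $H(2)$-datum for an associative algebra $B$: a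 pair $(\mathcal{F},c)$, $\mathcal{F}\in End_{\Bbbk}(B)$, $c\in B$ invertible, such that $\mathcal{F}$ is an algebra morphism, $\mathcal{F}^2(e)=cec^{-1}$ for all $e\in B$, and $\mathcal{F}(c)=-c$. $\left(\dfrac{\mathcal{F},c}{B}\right)$ is the crossed product $B\overline{\#}_{\sigma}H(2)$: the vector space $B\otimes H(2)$ with multiplication $(r\otimes h)(s\otimes g)=r(h_1\cdot s)\sigma(h_2,g_1)\otimes h_3g_2$, unit $1_B\otimes 1$, coaction $I_B\otimes\Delta$ and left $B$-action on the first factor, where $1\cdot e=e$, $x\cdot e=\mathcal{F}(e)$, $\sigma(x,x)=c$ and $\sigma(1,1)=\sigma(1,x)=\sigma(x,1)=1_B$. *)

(* Defs.v *)
From HB Require Import structures.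
From mathcomp Require Import all_boot all_order all_algebra.
Set Implicit Arguments.
Unset Strict Implicit.
Unset Printing Implicit Defensive.

Import GRing.Theory.
Local Open Scope ring_scope.

(* Unital, not necessarily associative, k-algebras; the zero algebra is       *)
(* allowed (unlike in algType), as it can occur as a comodule algebra.        *)
Record unitalAlg (k : fieldType) := UnitalAlg {
  ua_sort :> lmodType k;
  ua_mul : ua_sort -> ua_sort -> ua_sort;
  ua_one : ua_sort;
  ua_mul_linearl : forall b, linear (ua_mul^~ b);
  ua_mul_linearr : forall a, linear (ua_mul a);
  ua_mul1l : left_id ua_one ua_mul;
  ua_mul1r : right_id ua_one ua_mul
}.
Arguments ua_one {k} u.

Notation "a ** b" := (ua_mul a b) (at level 40, left associativity) :
  ring_scope.

Record assocAlg (k : fieldType) := AssocAlg {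
  aa_alg :> unitalAlg k;
  aa_mulA : forall a b c : aa_alg, a ** (b ** c) = (a ** b) ** c
}.

(* The basis {1, x} of H(2) is indexed by bool: false stands for 1 and true   *)
(* for x, so that the product of basis elements is addb.  As H(2) has a       *)
(* finite basis, V (x) H(2) is the space of families indexed by bool:         *)
(* t corresponds to t false (x) 1 + t true (x) x (lemma tensH_sum below).     *)
(* In particular H(2) itself is k (x) H(2).                                   *)
Notation tensH V := {ffun bool -> V}.
Notation H2 k := (tensH k^o).

Section QuasiHopf.
Variable k : fieldType.

Definition grp (i : bool) : H2 k := [ffun j => (i == j)%:R].

Definition pure (V : lmodType k) (v : V) (h : H2 k) : tensH V :=
  [ffun i => (h i : k) *: v].

Definition tmap (V W : lmodType k) (f : V -> W) (t : tensH V) : tensH W :=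
  [ffun i => f (t i)].

(* For a bilinear map f, the value at t of the linear map V (x) H(2) -> W     *)
(* induced by f: for t = v_0 (x) v_1 in Sweedler notation,                    *)
(* sweedler (fun v0 v1 => E) t is the sum denoted E.                          *)
Definition sweedler (V W : lmodType k) (f : V -> H2 k -> W) (t : tensH V) : W :=
  \sum_i f (t i) (grp i).

Lemma tensH_sum (V : lmodType k) (t : tensH V) : t = sweedler (@pure V) t.
Proof.
apply/ffunP => i; rewrite /sweedler sum_ffunE (bigD1 i) //= big1 => [|j ji].
  by rewrite addr0 !ffunE eqxx scale1r.
by rewrite !ffunE (negbTE ji) scale0r.
Qed.

Definition H2_ext (V : lmodType k) (f : bool -> V) (h : H2 k) : V :=
  \sum_i (h i : k) *: f i.

Definition H2_one : H2 k := grp false.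
Definition H2_mul (h g : H2 k) : H2 k :=
  H2_ext (fun i => H2_ext (fun j => grp (i (+) j)) g) h.
Definition H2_comul (h : H2 k) : tensH (H2 k) :=
  H2_ext (fun i => pure (grp i) (grp i)) h.
Definition H2_counit (h : H2 k) : k := H2_ext (fun=> 1 : k^o) h.
Definition H2_omega (h g l : H2 k) : k :=
  H2_ext (fun i => H2_ext (fun j => H2_ext (fun m =>
    (if [&& i, j & m] then - 1 else 1) : k^o) l) g) h.
Definition H2_antipode (h : H2 k) : H2 k := h.
Definition H2_alpha (h : H2 k) : k :=
  H2_ext (fun i => (if i then - 1 else 1) : k^o) h.
Definition H2_beta (h : H2 k) : k := H2_ext (fun=> 1 : k^o) h.

(* h_1 (x) h_2 (x) h_3 *)
Definition H2_comul3 (h : H2 k) : tensH (tensH (H2 k)) :=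
  tmap H2_comul (H2_comul h).

Definition is_comodule (V : lmodType k) (rho : V -> tensH V) : Prop :=
  (forall v, tmap rho (rho v) =
     sweedler (fun v0 v1 => sweedler (fun h1 h2 => pure (pure v0 h1) h2)
                              (H2_comul v1)) (rho v)) /\
  (forall v, sweedler (fun v0 v1 => H2_counit v1 *: v0) (rho v) = v).

Definition colinear (V W : lmodType k) (rhoV : V -> tensH V)
    (rhoW : W -> tensH W) (f : V -> W) : Prop :=
  forall v, rhoW (f v) = tmap f (rhoV v).

Record comodAlg := ComodAlg {
  ca_alg :> unitalAlg k;
  ca_coact : {linear ca_alg -> tensH ca_alg};
  ca_comodule : is_comodule ca_coact;
  ca_coact1 : ca_coact (ua_one ca_alg) = pure (ua_one ca_alg) H2_one;
  ca_coactM : forall a b : ca_alg, ca_coact (a ** b) =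
    sweedler (fun a0 a1 => sweedler (fun b0 b1 =>
      pure (a0 ** b0) (H2_mul a1 b1)) (ca_coact b)) (ca_coact a);
  ca_mulA : forall a b c : ca_alg, (a ** b) ** c =
    sweedler (fun a0 a1 => sweedler (fun b0 b1 => sweedler (fun c0 c1 =>
      H2_omega a1 b1 c1 *: (a0 ** (b0 ** c0)))
        (ca_coact c)) (ca_coact b)) (ca_coact a)
}.

Definition cleft (A : comodAlg) : Prop :=
  exists (gamma : {linear H2 k -> A}) (delta : {linear H2 k -> A}),
  [/\ colinear H2_comul (ca_coact A) gamma,
      forall h, ca_coact A (delta h) =
        sweedler (fun h1 h2 => pure (delta h2) (H2_antipode h1)) (H2_comul h),
      forall h, sweedler (fun h1 h2 => delta h1 ** gamma h2)
                  (H2_comul h) = H2_alpha h *: ua_one A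
    & forall h, sweedler (fun h12 h3 => sweedler (fun h1 h2 =>
                  H2_beta h2 *: (gamma h1 ** delta h3)) h12)
                  (H2_comul3 h) = H2_counit h *: ua_one A].

Definition comodAlg_iso (X A : comodAlg) (f : {linear X -> A}) : Prop :=
  [/\ bijective f,
      f (ua_one X) = ua_one A,
      forall y z, f (y ** z) = f y ** f z
    & colinear (ca_coact X) (ca_coact A) f].

Lemma H2_ext_grp (V : lmodType k) (f : bool -> V) i : H2_ext f (grp i) = f i.
Proof.
rewrite /H2_ext (bigD1 i) //= big1 => [|j ji].
  by rewrite !ffunE eqxx scale1r addr0.
by rewrite ffunE eq_sym (negbTE ji) scale0r.
Qed.

Lemma H2_mul_grp i j : H2_mul (grp i) (grp j) = grp (i (+) j).
Proof. by rewrite /H2_mul !H2_ext_grp. Qed.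

Lemma H2_comul_grp i : H2_comul (grp i) = pure (grp i) (grp i).
Proof. by rewrite /H2_comul !H2_ext_grp. Qed.

Lemma H2_counit_grp i : H2_counit (grp i) = 1.
Proof. by rewrite /H2_counit !H2_ext_grp. Qed.

Lemma H2_omega_grp i j l :
  H2_omega (grp i) (grp j) (grp l) = if [&& i, j & l] then - 1 else 1.
Proof. by rewrite /H2_omega !H2_ext_grp. Qed.

Lemma sweedler_pure (V W : lmodType k) (f : V -> H2 k -> W) v i :
  (forall j, f 0 (grp j) = 0) ->
  sweedler f (pure v (grp i)) = f v (grp i).
Proof.
move=> f0; rewrite /sweedler (bigD1 i) //= big1 => [|j ji].
  by rewrite !ffunE eqxx scale1r addr0.
by rewrite !ffunE eq_sym (negbTE ji) scale0r f0.
Qed.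

Lemma pureE (V : lmodType k) (v : V) i j :
  pure v (grp i) j = if i == j then v else 0.
Proof. by rewrite !ffunE; case: eqP; rewrite ?scale1r ?scale0r. Qed.

Lemma pure0 (V : lmodType k) (h : H2 k) : pure (0 : V) h = 0.
Proof. by apply/ffunP => i; rewrite !ffunE scaler0. Qed.

Lemma sweedler_fun0 (V W : lmodType k) (f : V -> H2 k -> W) t :
  (forall v i, f v (grp i) = 0) -> sweedler f t = 0.
Proof. by move=> f0; rewrite /sweedler big1 // => i _; rewrite f0. Qed.

Lemma pure_linear (V : lmodType k) (h : H2 k) : linear (fun v : V => pure v h).
Proof.
move=> a u v; apply/ffunP => i.
by rewrite !ffunE scalerDr !scalerA mulrC.
Qed.

End QuasiHopf.

Section UnitalAlgTheory.
Variables (k : fieldType) (A : unitalAlg k).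
Implicit Types a b u v : A.

Lemma ua_mul0l a : 0 ** a = 0.
Proof.
by have := ua_mul_linearl a (-1) 0 0; rewrite scaler0 addr0 scaleN1r addNr.
Qed.

Lemma ua_mul0r a : a ** 0 = 0.
Proof.
by have := ua_mul_linearr a (-1) 0 0; rewrite scaler0 addr0 scaleN1r addNr.
Qed.

Lemma ua_mulDl b u v : (u + v) ** b = u ** b + v ** b.
Proof. by have := ua_mul_linearl b 1 u v; rewrite !scale1r. Qed.

Lemma ua_mulDr a u v : a ** (u + v) = a ** u + a ** v.
Proof. by have := ua_mul_linearr a 1 u v; rewrite !scale1r. Qed.

Lemma ua_scaleAl (x : k) a b : (x *: a) ** b = x *: (a ** b).
Proof. by have := ua_mul_linearl b x a 0; rewrite ua_mul0l !addr0. Qed.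

Lemma ua_scaleAr (x : k) a b : a ** (x *: b) = x *: (a ** b).
Proof. by have := ua_mul_linearr a x b 0; rewrite ua_mul0r !addr0. Qed.

Lemma ua_mulNr a b : a ** (- b) = - (a ** b).
Proof. by rewrite -scaleN1r ua_scaleAr scaleN1r. Qed.

End UnitalAlgTheory.

Section Coinvariants.
Variables (k : fieldType) (A : comodAlg k).

Definition coinv_pred : {pred A} :=
  fun a => ca_coact A a == pure a (H2_one k).

Record coinv := Coinv { coinv_val : A; _ : coinv_val \in coinv_pred }.

HB.instance Definition _ := [isSub for coinv_val].
HB.instance Definition _ := [Choice of coinv by <:].

Fact coinv_submod : subsemimod_closed coinv_pred.
Proof.
have H a u v : u \in coinv_pred -> v \in coinv_pred ->
    a *: u + v \in coinv_pred.
  rewrite !unfold_in => /eqP hu /eqP hv.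
  by rewrite linearP hu hv pure_linear.
have H0 : 0 \in coinv_pred by rewrite unfold_in linear0 pure0.
split; first split => //.
  by move=> u v hu hv; rewrite -[u]scale1r H.
by move=> a u hu; rewrite -[_ *: _]addr0 H.
Qed.

HB.instance Definition _ :=
  GRing.SubChoice_isSubLmodule.Build k A coinv_pred coinv coinv_submod.

Fact coinv_coact (b : coinv) :
  ca_coact A (coinv_val b) = pure (coinv_val b) (H2_one k).
Proof. by apply/eqP; case: b. Qed.

Fact coinv_mulP (a b : coinv) : coinv_val a ** coinv_val b \in coinv_pred.
Proof.
rewrite unfold_in ca_coactM !coinv_coact !sweedler_pure ?H2_mul_grp //.
  by move=> j; rewrite ua_mul0r pure0.
by move=> j; apply: sweedler_fun0 => v i; rewrite ua_mul0l pure0.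
Qed.

Fact coinv_oneP : ua_one A \in coinv_pred.
Proof. by rewrite unfold_in ca_coact1. Qed.

Definition coinv_one : coinv := Coinv coinv_oneP.
Definition coinv_mul (a b : coinv) : coinv := Coinv (coinv_mulP a b).

Fact coinv_mulA : associative coinv_mul.
Proof.
move=> a b c; apply: val_inj; rewrite /= ca_mulA !coinv_coact.
rewrite sweedler_pure ?sweedler_pure ?sweedler_pure.
- by rewrite H2_omega_grp scale1r.
- by move=> j; rewrite !ua_mul0r scaler0.
- by move=> j; apply: sweedler_fun0 => v i; rewrite ua_mul0l ua_mul0r scaler0.
- move=> j; apply: sweedler_fun0 => v i; apply: sweedler_fun0 => w l.
  by rewrite ua_mul0l scaler0.
Qed.

Fact coinv_mul1l : left_id coinv_one coinv_mul.
Proof. by move=> a; apply: val_inj; rewrite /= ua_mul1l. Qed.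

Fact coinv_mul1r : right_id coinv_one coinv_mul.
Proof. by move=> a; apply: val_inj; rewrite /= ua_mul1r. Qed.

Fact coinv_linearl b : linear (coinv_mul^~ b).
Proof.
by move=> x u v; apply: val_inj; rewrite /= ua_mulDl ua_scaleAl.
Qed.

Fact coinv_linearr a : linear (coinv_mul a).
Proof.
by move=> x u v; apply: val_inj; rewrite /= ua_mulDr ua_scaleAr.
Qed.

Definition coinv_unitalAlg : unitalAlg k :=
  UnitalAlg coinv_linearl coinv_linearr coinv_mul1l coinv_mul1r.

Definition coinv_alg : assocAlg k := @AssocAlg k coinv_unitalAlg coinv_mulA.

Definition coinv_act (b : coinv) (a : A) : A := coinv_val b ** a.

End Coinvariants.

Record cleft_datum (k : fieldType) (B : assocAlg k) := CleftDatum {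
  cd_F : {linear B -> B};
  cd_c : B;
  cd_cV : B; (* the inverse of c *)
  cd_cVl : cd_cV ** cd_c = ua_one B;
  cd_cVr : cd_c ** cd_cV = ua_one B;
  cd_FM : forall e e', cd_F (e ** e') = cd_F e ** cd_F e';
  cd_F1 : cd_F (ua_one B) = ua_one B;
  cd_FF : forall e, cd_F (cd_F e) = cd_c ** e ** cd_cV;
  cd_Fc : cd_F cd_c = - cd_c
}.

Section Crossed.
Variables (k : fieldType) (B : assocAlg k) (D : cleft_datum B).
Local Notation F := (cd_F D).
Local Notation c := (cd_c D).

Definition cp_act (h : H2 k) (e : B) : B :=
  H2_ext (fun i => if i then F e else e) h.

Definition cp_sigma (h g : H2 k) : B :=
  H2_ext (fun i => H2_ext (fun j => if i && j then c else ua_one B) g) h.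

Definition cp_one : tensH B := pure (ua_one B) (H2_one k).

Definition cp_mul (y z : tensH B) : tensH B :=
  sweedler (fun r h => sweedler (fun s g =>
    sweedler (fun h12 h3 => sweedler (fun h1 h2 => sweedler (fun g1 g2 =>
      pure (r ** cp_act h1 s ** cp_sigma h2 g1) (H2_mul h3 g2))
        (H2_comul g)) h12) (H2_comul3 h)) z) y.

Definition cp_coact (y : tensH B) : tensH (tensH B) :=
  sweedler (fun r h => sweedler (fun h1 h2 => pure (pure r h1) h2)
                         (H2_comul h)) y.

Fact cp_coactE y i j : cp_coact y i j = if i == j then y i else 0.
Proof.
rewrite /cp_coact /sweedler big_bool /= !H2_comul_grp !big_bool.
rewrite !ffunE.
case: i; case: j; rewrite /= ?(scale1r, scale0r, scaler0, addr0, add0r) //.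
Qed.

Fact cp_mul_grp (r s : B) i j :
  sweedler (fun h12 h3 => sweedler (fun h1 h2 => sweedler (fun g1 g2 =>
    pure (r ** cp_act h1 s ** cp_sigma h2 g1) (H2_mul h3 g2))
      (H2_comul (grp k j))) h12) (H2_comul3 (grp k i)) =
  pure (r ** (if i then F s else s) ** (if i && j then c else ua_one B))
       (grp k (i (+) j)).
Proof.
have act0 e : cp_act 0 e = 0.
  by rewrite /cp_act /H2_ext big1 // => l _; rewrite ffunE scale0r.
have sig0 g : cp_sigma 0 g = 0.
  by rewrite /cp_sigma /H2_ext big1 // => l _; rewrite ffunE scale0r.
have sig0r h : cp_sigma h 0 = 0.
  rewrite /cp_sigma /H2_ext big1 // => l _; rewrite big1 ?scaler0 // => m _.
  by rewrite ffunE scale0r.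
have -> : H2_comul3 (grp k i) = pure (pure (grp k i) (grp k i)) (grp k i).
  apply/ffunP => l; rewrite /H2_comul3 ffunE H2_comul_grp !pureE.
  case: eqP => _; first by rewrite H2_comul_grp.
  by rewrite /H2_comul /H2_ext big1 // => m _; rewrite ffunE scale0r.
rewrite H2_comul_grp sweedler_pure ?sweedler_pure ?sweedler_pure.
- by rewrite H2_mul_grp /cp_act /cp_sigma !H2_ext_grp.
- by move=> l; rewrite sig0r ua_mul0r pure0.
- move=> l; apply: sweedler_fun0 => v m.
  by rewrite act0 ua_mul0r ua_mul0l pure0.
- move=> l; rewrite /sweedler big1 // => m _; rewrite ffunE.
  by rewrite big1 // => n _; rewrite act0 ua_mul0r ua_mul0l pure0.
Qed.

Fact cp_mulE (y z : tensH B) : cp_mul y z =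
  [ffun i => if i then y false ** z true + y true ** F (z false)
             else y false ** z false + y true ** F (z true) ** c].
Proof.
have -> : cp_mul y z = \sum_i \sum_j
    pure (y i ** (if i then F (z j) else z j) **
            (if i && j then c else ua_one B)) (grp k (i (+) j)).
  by apply: eq_bigr => i _; apply: eq_bigr => j _; apply: cp_mul_grp.
apply/ffunP => i; rewrite !big_bool !ffunE /=.
by case: i; rewrite /= ?scale1r ?scale0r ?addr0 ?add0r ?ua_mul1r // addrC.
Qed.

Fact cp_mul_pure (r s : B) i j :
  cp_mul (pure r (grp k i)) (pure s (grp k j)) =
  pure (r ** (if i then F s else s) ** (if i && j then c else ua_one B))
       (grp k (i (+) j)).
Proof.
apply/ffunP => l; rewrite cp_mulE !ffunE.
by case: i; case: j; case: l;
  rewrite /= ?scale1r ?scale0r ?linear0 ?(ua_mul0l, ua_mul0r) ?addr0 ?add0r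
             ?ua_mul0l ?ua_mul1r.
Qed.

Fact cp_coact_pure (y : tensH B) i : cp_coact y i = pure (y i) (grp k i).
Proof. by apply/ffunP => j; rewrite cp_coactE pureE. Qed.

Fact cp_linearl z : linear (cp_mul^~ z).
Proof.
move=> a u v; apply/ffunP => i; rewrite !cp_mulE !ffunE.
by case: i; rewrite !(ua_mulDl, ua_scaleAl) scalerDr addrACA.
Qed.

Fact cp_linearr y : linear (cp_mul y).
Proof.
move=> a u v; apply/ffunP => i; rewrite !cp_mulE !ffunE.
case: i; rewrite !linearP !(ua_mulDr, ua_scaleAr, ua_mulDl, ua_scaleAl).
  by rewrite scalerDr addrACA.
by rewrite scalerDr addrACA.
Qed.

Fact cp_mul1l : left_id cp_one cp_mul.
Proof.
move=> y; apply/ffunP => i; rewrite cp_mulE !ffunE /=.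
by case: i; rewrite scale1r scale0r !ua_mul0l ua_mul1l addr0.
Qed.

Fact cp_mul1r : right_id cp_one cp_mul.
Proof.
move=> y; apply/ffunP => i; rewrite cp_mulE !ffunE /= scale1r scale0r linear0.
by case: i; rewrite !ua_mul0r ?cd_F1 ua_mul1r ?ua_mul0l ?addr0 ?add0r.
Qed.

Definition cp_unitalAlg : unitalAlg k :=
  UnitalAlg cp_linearl cp_linearr cp_mul1l cp_mul1r.

Fact cp_coact_linear : linear cp_coact.
Proof.
move=> a u v; apply/ffunP => i; apply/ffunP => j.
rewrite cp_coactE !ffunE !cp_coactE.
by case: eqP => _ //; rewrite scaler0 addr0.
Qed.

HB.instance Definition _ := GRing.isLinear.Build k (tensH B)
  (tensH (tensH B)) *:%R cp_coact cp_coact_linear.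

Fact cp_comodule : is_comodule cp_coact.
Proof.
split=> y.
  have E (v : tensH B) i :
      sweedler (fun h1 h2 => pure (pure v h1) h2) (H2_comul (grp k i)) =
      pure (pure v (grp k i)) (grp k i).
    rewrite H2_comul_grp sweedler_pure // => m.
    by apply/ffunP => n; apply/ffunP=> o; rewrite !ffunE !scale0r !scaler0.
  rewrite [RHS]/sweedler big_bool /= !E !cp_coact_pure.
  apply/ffunP => i; apply/ffunP => j; apply/ffunP => l.
  rewrite ffunE cp_coact_pure cp_coactE !ffunE.
  by case: i; case: j; case: l;
    rewrite /= ?scale1r ?scale0r ?scaler0 ?addr0 ?add0r.
rewrite /sweedler big_bool /= !H2_counit_grp !scale1r !cp_coact_pure.
by apply/ffunP => -[]; rewrite !ffunE /= scale1r scale0r ?addr0 ?add0r.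
Qed.

Fact cp_coact1 : cp_coact cp_one = pure cp_one (H2_one k).
Proof.
apply/ffunP => i; rewrite cp_coact_pure; apply/ffunP => j; rewrite !ffunE.
by case: i; case: j; rewrite /= ?scale1r ?scale0r ?scaler0.
Qed.

Fact cp_coactM (x y : tensH B) : cp_coact (cp_mul x y) =
  sweedler (fun a0 a1 => sweedler (fun b0 b1 =>
    pure (cp_mul a0 b0) (H2_mul a1 b1)) (cp_coact y)) (cp_coact x).
Proof.
rewrite /sweedler !big_bool !cp_coact_pure /= !H2_mul_grp !cp_mul_pure /=.
apply/ffunP => i; apply/ffunP => j; rewrite cp_coactE cp_mulE !ffunE.
by case: i; case: j; rewrite /= ?(ua_mul1r, scale1r, scale0r, scaler0)
  ?(addr0, add0r) // addrC.
Qed.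

Fact cp_mulA (x y z : tensH B) : cp_mul (cp_mul x y) z =
  sweedler (fun a0 a1 => sweedler (fun b0 b1 => sweedler (fun c0 c1 =>
    H2_omega a1 b1 c1 *: cp_mul a0 (cp_mul b0 c0))
      (cp_coact z)) (cp_coact y)) (cp_coact x).
Proof.
have cF e : c ** e = F (F e) ** c.
  by rewrite cd_FF -!aa_mulA cd_cVl ua_mul1r.
rewrite /sweedler !big_bool !cp_coact_pure /= !H2_omega_grp !cp_mul_pure /=.
apply/ffunP => i; rewrite !cp_mulE !ffunE /=.
have S4 (a b d e : B) : a + b + (d + e) = b + e + (d + a).
  by rewrite (AC (2*2) ((2*4)*(3*1))).
case: i; rewrite /= ?(ua_mul1r, scale1r, scale0r, scaler0, addr0, add0r,
  scaleN1r, oppr0) !cd_FM ?cd_Fc ?ua_mulNr ?opprK !ua_mulDl ?ua_mulDl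
  -!aa_mulA cF; exact: S4.
Qed.

Definition crossed_product : comodAlg k :=
  @ComodAlg k cp_unitalAlg cp_coact cp_comodule cp_coact1 cp_coactM cp_mulA.

Definition cp_lact (b : B) (y : crossed_product) : crossed_product :=
  tmap (ua_mul b) (y : tensH B).

End Crossed.

(* Main.v *)
Require Import Defs.
From HB Require Import structures.
From mathcomp Require Import all_boot all_order all_algebra.
Import GRing.Theory.
Local Open Scope ring_scope.

(** An H(2)-coaction on A is a C_2-grading A = A_0 + A_1, the coinvariants are
    B = A_0, and the reassociator says that (a b) c = a (b c) for homogeneous
    a, b, c, except that the two sides are opposite when all three have
    degree 1.  Write u = gamma(x) and v = delta(x); both have degree 1, and the
    cleft conditions at x read u v = 1 and v u = -1.  The sign in the latter is
    the one that makes u invertible in the quasi-associative sense: for r in A_0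
    and a in A_1,
      (r u) v = r (u v) = r   and   (a v) u = - a (v u) = a,
    so r |-> r u is a bijection from A_0 to A_1, with inverse a |-> a v.  As a
    left B-module, A is therefore free on 1 and u.

    The datum is read off from u: F e is the only element of B with
    (F e) u = u e, namely F e = (u e) v, and c = u u.  Cancelling u on the right,
    F is an algebra morphism with (F (F e)) c = c e.  The anomaly enters twice:
    c is inverted by - v v, and F c = - c because u (u u) = - (u u) u.  The
    isomorphism from the crossed product sends r (x) 1 + s (x) x to r + s u. *)

(** * The grading defined by a coaction *)

Section Homogeneous.
Context {k : fieldType} {A : comodAlg k}.
Implicit Types a b c : A.

Definition homog (i : bool) a : Prop := ca_coact A a = pure a (grp k i).

Lemma homogM {i j : bool} {a b} :
  homog i a -> homog j b -> homog (i (+) j) (a ** b).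
Proof.
rewrite /homog ca_coactM => -> ->; rewrite !sweedler_pure ?H2_mul_grp //.
  by move=> l; rewrite ua_mul0r pure0.
by move=> l; apply: sweedler_fun0 => w m; rewrite ua_mul0l pure0.
Qed.

Lemma homog_mulA {i j l : bool} {a b c} :
  homog i a -> homog j b -> homog l c ->
  (a ** b) ** c =
    (if [&& i, j & l] then - 1 else 1 : k) *: (a ** (b ** c)).
Proof.
rewrite ca_mulA => -> -> ->.
rewrite sweedler_pure ?sweedler_pure ?sweedler_pure.
- by rewrite H2_omega_grp.
- by move=> m; rewrite !ua_mul0r scaler0.
- by move=> m; apply: sweedler_fun0 => w n; rewrite ua_mul0l ua_mul0r scaler0.
- move=> m; apply: sweedler_fun0 => w n; apply: sweedler_fun0 => w' n'.
  by rewrite ua_mul0l scaler0.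
Qed.

Lemma homog_assoc {i j l : bool} {a b c} :
  homog i a -> homog j b -> homog l c -> [&& i, j & l] = false ->
  (a ** b) ** c = a ** (b ** c).
Proof. by move=> ha hb hc E; rewrite (homog_mulA ha hb hc) E scale1r. Qed.

Lemma homog_odd_mulA {a b c} :
  homog true a -> homog true b -> homog true c ->
  (a ** b) ** c = - (a ** (b ** c)).
Proof. by move=> ha hb hc; rewrite (homog_mulA ha hb hc) scaleN1r. Qed.

Lemma homog_coact a i : homog i (ca_coact A a i).
Proof.
have [coassoc _] := ca_comodule A; have /ffunP/(_ i) := coassoc a.
rewrite /homog ffunE => ->; rewrite /sweedler !big_bool /= !H2_comul_grp.
apply/ffunP=> j; rewrite !ffunE.
by case: i; case: j;
  rewrite /= ?(scale1r, scale0r, scaler0) ?(addr0, add0r).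
Qed.

Lemma coact_sum a : ca_coact A a false + ca_coact A a true = a.
Proof.
have [_ counit] := ca_comodule A; have := counit a.
by rewrite /sweedler big_bool /= !H2_counit_grp !scale1r addrC.
Qed.

Lemma homog_coinv (e : coinv A) : homog false (coinv_val e).
Proof. exact: coinv_coact. Qed.

Lemma coinv_homog a : homog false a -> a \in coinv_pred (A := A).
Proof. by move=> ha; apply/eqP. Qed.

End Homogeneous.

(** * The datum and the isomorphism attached to an invertible odd element *)

Section OddUnit.
Context {k : fieldType} {A : comodAlg k} {u v : A}.
Hypotheses (hu : homog true u) (hv : homog true v).
Hypotheses (uv : u ** v = ua_one A) (vu : v ** u = - ua_one A).
Local Notation B := (coinv_alg A).
Local Notation val0 := (@coinv_val k A).
Implicit Types (e r s : coinv A) (a : A).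

Lemma even_mulK a : homog false a -> (a ** u) ** v = a.
Proof. by move=> ha; rewrite (homog_assoc ha hu hv erefl) uv ua_mul1r. Qed.

Lemma odd_mulK a : homog true a -> (a ** v) ** u = a.
Proof.
by move=> ha; rewrite (homog_odd_mulA ha hv hu) vu ua_mulNr opprK ua_mul1r.
Qed.

Lemma twist_subproof e : (u ** val0 e) ** v \in coinv_pred (A := A).
Proof. exact/coinv_homog/(homogM (homogM hu (homog_coinv e)) hv). Qed.

Definition twist e : coinv A := Coinv (twist_subproof e).

Lemma twist_linear : linear twist.
Proof.
move=> x r s; apply: val_inj => /=.
by rewrite ua_mulDr ua_scaleAr ua_mulDl ua_scaleAl.
Qed.

HB.instance Definition _ :=
  GRing.isLinear.Build k (coinv A) (coinv A) *:%R twist twist_linear.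

Lemma twistE e : val0 (twist e) ** u = u ** val0 e.
Proof. by rewrite odd_mulK //; apply: (homogM hu (homog_coinv e)). Qed.

(** As r |-> r u is injective on B, an identity between values of the twist can
    be proved after multiplying by u. *)
Lemma twist_unique e r : val0 r ** u = u ** val0 e -> twist e = r.
Proof.
rewrite -twistE => E; apply: val_inj.
by rewrite -[LHS]even_mulK -?E ?even_mulK //; apply: homog_coinv.
Qed.

Definition sqr_odd : coinv A := Coinv (coinv_homog _ (homogM hu hu)).
Definition sqr_odd_inv : coinv A := - Coinv (coinv_homog _ (homogM hv hv)).

Lemma sqr_oddVl : coinv_mul sqr_odd_inv sqr_odd = coinv_one A.
Proof.
apply: val_inj; rewrite -[LHS]/(- (v ** v) ** (u ** u)).
rewrite -scaleN1r ua_scaleAl -(homog_assoc (homogM hv hv) hu hu erefl).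
rewrite (homog_odd_mulA hv hv hu) vu ua_mulNr ua_mul1r opprK vu.
by rewrite scaleN1r opprK.
Qed.

Lemma sqr_oddVr : coinv_mul sqr_odd sqr_odd_inv = coinv_one A.
Proof.
apply: val_inj; rewrite -[LHS]/((u ** u) ** - (v ** v)) ua_mulNr.
rewrite -(homog_assoc (homogM hu hu) hv hv erefl).
by rewrite (homog_mulA hu hu hv) uv ua_mul1r ua_scaleAl uv scaleN1r opprK.
Qed.

Lemma twistM e r : twist (coinv_mul e r) = coinv_mul (twist e) (twist r).
Proof.
have [he hr] := (homog_coinv e, homog_coinv r).
have [hte htr] := (homog_coinv (twist e), homog_coinv (twist r)).
apply: twist_unique.
rewrite -[LHS]/((val0 (twist e) ** val0 (twist r)) ** u).
rewrite (homog_assoc hte htr hu erefl) twistE.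
rewrite -(homog_assoc hte hu hr erefl) twistE.
exact: homog_assoc hu he hr erefl.
Qed.

Lemma twist1 : twist (coinv_one A) = coinv_one A.
Proof. by apply: twist_unique; rewrite /= ua_mul1l ua_mul1r. Qed.

Lemma twist_twist_sqr e :
  coinv_mul (twist (twist e)) sqr_odd = coinv_mul sqr_odd e.
Proof.
have [ht htt] := (homog_coinv (twist e), homog_coinv (twist (twist e))).
apply: val_inj; rewrite -[LHS]/(val0 (twist (twist e)) ** (u ** u)).
rewrite -(homog_assoc htt hu hu erefl) twistE.
rewrite (homog_assoc hu ht hu erefl) twistE.
by rewrite -(homog_assoc hu hu (homog_coinv e) erefl).
Qed.

Lemma twist_twist e :
  twist (twist e) = coinv_mul (coinv_mul sqr_odd e) sqr_odd_inv.
Proof.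
by rewrite -twist_twist_sqr -coinv_mulA sqr_oddVr coinv_mul1r.
Qed.

(** The relation F c = - c is the failure of u to associate with itself. *)
Lemma twist_sqr : twist sqr_odd = - sqr_odd.
Proof.
apply: twist_unique; rewrite -[LHS]/(- (u ** u) ** u).
by rewrite -scaleN1r ua_scaleAl (homog_odd_mulA hu hu hu) scaleN1r opprK.
Qed.

Definition odd_datum : cleft_datum B :=
  @CleftDatum k B twist sqr_odd sqr_odd_inv
    sqr_oddVl sqr_oddVr twistM twist1 twist_twist twist_sqr.

Definition odd_iso (y : crossed_product odd_datum) : A :=
  val0 ((y : tensH B) false) + val0 ((y : tensH B) true) ** u.

Lemma odd_iso_linear : linear odd_iso.
Proof.
move=> x y z; rewrite /odd_iso !ffunE /=.
by rewrite ua_mulDl ua_scaleAl scalerDr addrACA.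
Qed.

HB.instance Definition _ :=
  GRing.isLinear.Build k (crossed_product odd_datum) A *:%R odd_iso
    odd_iso_linear.

Lemma odd_iso1 : odd_iso (ua_one (crossed_product odd_datum)) = ua_one A.
Proof.
by rewrite /odd_iso !ffunE /= scale1r scale0r ua_mul0l addr0.
Qed.

Lemma coact_odd_iso (y : crossed_product odd_datum) :
  ca_coact A (odd_iso y) =
    pure (val0 ((y : tensH B) false)) (grp k false) +
    pure (val0 ((y : tensH B) true) ** u) (grp k true).
Proof.
by rewrite /odd_iso linearD /= coinv_coact (homogM (homog_coinv _) hu).
Qed.

Lemma odd_iso_colinear :
  colinear (ca_coact (crossed_product odd_datum)) (ca_coact A) odd_iso.
Proof.
move=> y; rewrite coact_odd_iso; apply/ffunP=> i.
rewrite /tmap [RHS]ffunE /odd_iso !cp_coactE !ffunE.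
by case: i; rewrite /= ?(scale1r, scale0r) ?ua_mul0l.
Qed.

Lemma odd_iso_bij : bijective odd_iso.
Proof.
pose g a : crossed_product odd_datum := [ffun i =>
  if i then Coinv (coinv_homog _ (homogM (homog_coact a true) hv))
  else Coinv (coinv_homog _ (homog_coact a false))].
exists g => [y | a].
  apply/ffunP=> i; rewrite ffunE; case: i; apply: val_inj => /=;
    rewrite coact_odd_iso !ffunE /= scale1r scale0r ?addr0 ?add0r //.
  by rewrite even_mulK //; apply: homog_coinv.
rewrite /odd_iso !ffunE /= odd_mulK ?coact_sum //; exact: homog_coact.
Qed.

Lemma odd_isoM (y z : crossed_product odd_datum) :
  odd_iso (y ** z) = odd_iso y ** odd_iso z.
Proof.
rewrite /odd_iso [_ ** z]cp_mulE !ffunE.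
move: ((y : tensH B) false) ((y : tensH B) true) => r r'.
move: ((z : tensH B) false) ((z : tensH B) true) => s s'.
have [hr' hs'] := (homog_coinv r', homog_coinv s').
have [hts hts'] := (homog_coinv (twist s), homog_coinv (twist s')).
have r_su : val0 r ** (val0 s' ** u) = (val0 r ** val0 s') ** u.
  by rewrite (homog_assoc (homog_coinv r) hs' hu erefl).
have ru_s : (val0 r' ** u) ** val0 s = (val0 r' ** val0 (twist s)) ** u.
  rewrite (homog_assoc hr' hu (homog_coinv s) erefl) -twistE.
  by rewrite (homog_assoc hr' hts hu erefl).
have ru_su : (val0 r' ** u) ** (val0 s' ** u) =
    (val0 r' ** val0 (twist s')) ** (u ** u).
  rewrite -(homog_assoc (homogM hr' hu) hs' hu erefl).
  rewrite (homog_assoc hr' hu hs' erefl) -twistE.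
  rewrite -(homog_assoc (homogM hr' hts') hu hu erefl).
  by rewrite (homog_assoc hr' hts' hu erefl).
transitivity
  ((val0 r ** val0 s + (val0 r' ** val0 (twist s')) ** (u ** u)) +
   (val0 r ** val0 s' + val0 r' ** val0 (twist s)) ** u) => //.
rewrite !ua_mulDl !ua_mulDr r_su ru_s ru_su.
by rewrite (AC (2*2) ((1*3)*(4*2))).
Qed.

Lemma odd_iso_lact (b : B) (y : crossed_product odd_datum) :
  odd_iso (cp_lact b y) = coinv_act b (odd_iso y).
Proof.
rewrite /odd_iso /coinv_act !ffunE /= ua_mulDr; congr (_ + _).
by rewrite (homog_assoc (homog_coinv _) (homog_coinv _) hu erefl).
Qed.

End OddUnit.

(** * The odd unit of a cleft extension *)

Section CleftOddUnit.
Context {k : fieldType} {A : comodAlg k}.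

Lemma comul3_grp i :
  H2_comul3 (grp k i) = pure (pure (grp k i) (grp k i)) (grp k i).
Proof.
rewrite /H2_comul3 H2_comul_grp; apply/ffunP=> j; rewrite ffunE !pureE.
case: eqP => _; first exact: H2_comul_grp.
by rewrite /H2_comul /H2_ext big1 // => l _; rewrite ffunE scale0r.
Qed.

(** As x is grouplike, each Sweedler sum at x is a single term: colinearity
    puts gamma x and delta x in degree 1, and the last two cleft conditions
    become the products v u = alpha(x) = - 1 and u v = epsilon(x) = 1. *)
Lemma cleft_odd_unit : cleft A -> exists u v : A,
  [/\ homog true u, homog true v, u ** v = ua_one A & v ** u = - ua_one A].
Proof.
move=> [gamma [delta [hg hd dg gd]]].
have tmap_pure (f : {linear H2 k -> A}) i :
    tmap f (pure (grp k i) (grp k i)) = pure (f (grp k i)) (grp k i).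
  by apply/ffunP=> j; rewrite !ffunE linearZ.
exists (gamma (grp k true)), (delta (grp k true)); split.
- by rewrite /homog hg H2_comul_grp tmap_pure.
- rewrite /homog hd H2_comul_grp /sweedler big_bool /= !pureE /=.
  by apply/ffunP=> j; rewrite !ffunE scale0r addr0.
- have := gd (grp k true); rewrite H2_counit_grp scale1r => <-.
  rewrite comul3_grp !sweedler_pure.
  + by rewrite /H2_beta H2_ext_grp scale1r.
  + by move=> j; rewrite linear0 ua_mul0l scaler0.
  + by move=> j; apply: big1 => l _; rewrite ffunE linear0 ua_mul0l scaler0.
- have := dg (grp k true); rewrite /H2_alpha H2_ext_grp scaleN1r => <-.
  rewrite H2_comul_grp /sweedler big_bool /= !pureE /=.
  by rewrite linear0 ua_mul0l addr0.
Qed.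

End CleftOddUnit.

Theorem corollary39 (k : fieldType) (hk : 2%N \notin [pchar k])
    (A : comodAlg k) (hA : cleft A) :
  exists (D : cleft_datum (coinv_alg A)) (f : {linear crossed_product D -> A}),
    comodAlg_iso f /\ forall b y, f (cp_lact b y) = coinv_act b (f y).
Proof.
have [u [v [hu hv uv vu]]] := cleft_odd_unit hA.
exists (odd_datum hu hv uv vu).
exists (odd_iso hu hv uv vu : {linear _ -> _}).
split; last exact: odd_iso_lact.
split.
- exact: odd_iso_bij.
- exact: odd_iso1.
- exact: odd_isoM.
- exact: odd_iso_colinear.
Qed.
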